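(* Let $\mathbf{o}_R$ be a random vector uniformly distributed on the unit sphere $\mathcal{S}\subset\mathbb{R}^3$, and let $\mathbf{v}=\mathbf{v}_{\rm Re}+j\,\mathbf{v}_{\rm Im}\in\mathbb{C}^3$ be non-random, with linearly independent $\mathbf{v}_{\rm Re},\mathbf{v}_{\rm Im}\in\mathbb{R}^3$. Let $v_{\rm Re}=\|\mathbf{v}_{\rm Re}\|$, $v_{\rm Im}=\|\mathbf{v}_{\rm Im}\|$ and $\rho=\dfrac{\mathbf{v}_{\rm Re}^{\mathsf T}\mathbf{v}_{\rm Im}}{v_{\rm Re}v_{\rm Im}}$. Let $h=\mathbf{o}_R^{\mathsf T}\mathbf{v}$, i.e. $\mathrm{Re}(h)=\mathbf{o}_R^{\mathsf T}\mathbf{v}_{\rm Re}$ and $\mathrm{Im}(h)=\mathbf{o}_R^{\mathsf T}\mathbf{v}_{\rm Im}$. Then the joint probability density function of $(\mathrm{Re}(h),\mathrm{Im}(h))$ with respect to Lebesgue measure on $\mathbb{R}^2\cong\mathbb{C}$ is $$f(h\,|\,\mathbf{v})=\frac{1}{v_{\rm Re}v_{\rm Im}\sqrt{1-\rho^2}}\;\psi\!\left(\left\|\begin{bmatrix}1&0\\ \rho&\sqrt{1-\rho^2}\end{bmatrix}^{-1}\begin{bmatrix}\mathrm{Re}(h)/v_{\rm Re}\\ \mathrm{Im}(h)/v_{\rm Im}\end{bmatrix}\right\|^2\right),$$ where $\psi(x)=\dfrac{1}{2\pi\sqrt{1-x}}$ for $x\in[0,1]$ and $\psi(x)=0$ otherwise.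 Moreover, the marginal distributions are uniform: $\mathrm{Re}(h)\sim\mathcal{U}(-v_{\rm Re},v_{\rm Re})$ and $\mathrm{Im}(h)\sim\mathcal{U}(-v_{\rm Im},v_{\rm Im})$.
   Context: $j$ is the imaginary unit, $\|\cdot\|$ the Euclidean norm, and $\mathcal{U}(a,b)$ the uniform distribution on the interval $(a,b)$. The value of $\psi$ at $x=1$ is immaterial, since it affects the density only on a Lebesgue-null set. *)

(* Defs.v *)
From HB Require Import structures.
From mathcomp Require Import all_boot all_order all_algebra.
From mathcomp Require Import all_classical all_reals all_analysis.
From mathcomp Require Import complex.

Set Implicit Arguments.
Unset Strict Implicit.
Unset Printing Implicit Defensive.

Import Order.TTheory GRing.Theory Num.Theory.
Import numFieldNormedType.Exports.

Local Open Scope classical_set_scope.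
Local Open Scope ring_scope.

(* The library's norm on matrices is the sup norm. *)
Definition enorm (R : realType) (n : nat) (u : 'cV[R]_n) : R :=
  Num.sqrt (\sum_i u i 0 ^+ 2).

(* measurableTypeR R is R with its Borel sigma-algebra, the type on which
   lebesgue_measure is declared. *)
Notation Rplane R := (measurableTypeR R * measurableTypeR R)%type.
Notation Rspace R :=
  (measurableTypeR R * measurableTypeR R * measurableTypeR R)%type.

Definition vec3 (R : realType) (x : Rspace R) : 'cV[R]_3 :=
  \col_i [:: x.1.1 : R; x.1.2 : R; x.2 : R]`_i.

Definition lebesgue2 (R : realType) : {measure set (Rplane R) -> \bar R} :=
  (@lebesgue_measure R \x @lebesgue_measure R)%E.

Definition lebesgue3 (R : realType) : {measure set (Rspace R) -> \bar R} :=
  ((@lebesgue_measure R \x @lebesgue_measure R) \x @lebesgue_measure R)%E.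

Definition unit_sphere (R : realType) : set (Rspace R) :=
  [set x | enorm (vec3 x) = 1].

Definition scale3 (R : realType) (r : R) (x : Rspace R) : Rspace R :=
  (r * x.1.1, r * x.1.2, r * x.2).

(* Surface measure of A on the unit sphere of R^3, defined (as usual for polar
   coordinates) as 3 times the volume of the solid cone
   {r x | 0 < r <= 1, x in A, |x| = 1} spanned by A. *)
Definition surface_measure (R : realType) (A : set (Rspace R)) : \bar R :=
  (3%:E * lebesgue3 R
    [set y | exists (r : R) (x : Rspace R),
       [/\ 0 < r <= 1, A x, unit_sphere x & y = scale3 r x]%R])%E.

Definition uniform_on_sphere (R : realType) (d : measure_display)
    (T : measurableType d) (P : probability T R)
    (X : {RV P >-> Rspace R}) : Prop :=
  forall A : set (Rspace R), measurable A ->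
    distribution P X A =
    ((fine (surface_measure (@unit_sphere R)))^-1%:E * surface_measure A)%E.

Definition has_density (R : realType) (d d' : measure_display)
    (T : measurableType d) (T' : measurableType d') (P : probability T R)
    (X : T -> T') (mu : {measure set T' -> \bar R}) (f : T' -> R) : Prop :=
  [/\ measurable_fun setT X, measurable_fun setT f, (forall x, 0 <= f x) &
      forall B, measurable B -> P (X @^-1` B) = (\int[mu]_(x in B) (f x)%:E)%E].

Definition has_uniform_law (R : realType) (d : measure_display)
    (T : measurableType d) (P : probability T R) (X : T -> R) (a b : R) : Prop :=
  measurable_fun setT X /\
  exists ab : a < b, forall B, measurable B -> P (X @^-1` B) = uniform_prob ab B.

Section channel.
Variable R : realType.
Implicit Types (v : 'cV[R[i]]_3) (h : R[i]) (x : R).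

Definition vRe v : 'cV[R]_3 := map_mx (@complex.Re R) v.
Definition vIm v : 'cV[R]_3 := map_mx (@complex.Im R) v.

Definition rho v : R :=
  ((vRe v)^T *m vIm v) 0 0 / (enorm (vRe v) * enorm (vIm v)).

Definition channel (o : Rspace R) v : R[i] :=
  ((map_mx (real_complex R) (vec3 o))^T *m v) 0 0.

(* At x = 1 the value is 0, since 0^-1 = 0. *)
Definition psi x : R :=
  if 0 <= x <= 1 then (2 * pi * Num.sqrt (1 - x))^-1 else 0.

Definition chol v : 'M[R]_(1 + 1) :=
  block_mx 1%:M 0 (rho v)%:M (Num.sqrt (1 - rho v ^+ 2))%:M.

Definition channel_pdf v h : R :=
  (enorm (vRe v) * enorm (vIm v) * Num.sqrt (1 - rho v ^+ 2))^-1 *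
  psi (enorm (invmx (chol v) *m
         col_mx (complex.Re h / enorm (vRe v))%:M
                (complex.Im h / enorm (vIm v))%:M) ^+ 2).

End channel.

(* Main.v *)
Require Import Defs.
From HB Require Import structures.
From mathcomp Require Import all_boot all_order all_algebra.
From mathcomp Require Import fingroup perm.
From mathcomp Require Import all_classical all_reals all_analysis.
From mathcomp Require Import complex.
From mathcomp Require Import measurable_realfun.
From mathcomp Require Import ring lra.

Set Implicit Arguments.
Unset Strict Implicit.
Unset Printing Implicit Defensive.

Import Order.TTheory GRing.Theory Num.Theory.
Import numFieldNormedType.Exports.

Local Open Scope classical_set_scope.
Local Open Scope ring_scope.

(* Write a, b for the real and imaginary parts of v and n for the unit vector
   along a x b. The form Q on the plane with |y|^2 = Q(a.y, b.y) + (n.y)^2 is the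
   squared norm inside psi. The linear map y |-> (a.y, b.y, n.y) multiplies
   volumes by a constant and sends the solid cone over {o | (o.a, o.b) in B} to
   {(z, w) | 0 < r <= 1, z / r in B} with r = sqrt (Q z + w^2). Replacing w by r
   at fixed z, and then z by u = z / r at fixed r, turns the volume of the latter
   into a constant times the integral of 1 / sqrt (1 - Q u) over B. None of the
   constants is computed: the law of (Re h, Im h) and the density are
   proportional, and both have total mass 1. The mass of the density comes from
   its first marginal, where the arcsine integral produces pi; the marginal of
   Im h is that of Re h for the vector with a and b exchanged. *)

(** * One-dimensional change of variables *)

Section measurability.
Context (R : realType).

(** The inverse of [f x] is [f x] times the power -1 of its square, and real powers are measurable.
    At a zero of [f] both sides vanish because [0^-1 = 0]. *)
Lemma measurable_funV d (T : measurableType d) (D : set T) (f : T -> R) :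
  measurable_fun D f -> measurable_fun D (fun x => (f x)^-1).
Proof.
move=> mf; have -> : (fun x => (f x)^-1) = (fun x => f x * (f x ^+ 2) `^ (-1)).
  apply/funext => x; rewrite powR_inv1 ?sqr_ge0//.
  have [->|fx0] := eqVneq (f x) 0; first by rewrite invr0 mul0r.
  by rewrite expr2 invfM mulrA divff// mul1r.
apply: measurable_funM => //.
by apply: (measurableT_comp (measurable_powR _)); exact: measurable_funX.
Qed.

Lemma measurable_sqrt d (T : measurableType d) (D : set T) (f : T -> R) :
  measurable_fun D f -> measurable_fun D (fun x => Num.sqrt (f x)).
Proof.
move=> mf; apply: (measurableT_comp _ mf).
by apply: continuous_measurable_fun => x; exact: sqrt_continuous.
Qed.

End measurability.

Section change_of_variables.
Context (R : realType).
Local Notation mu := (@lebesgue_measure R).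
Local Open Scope ereal_scope.

(** Split over [D] and its complement: on subsets of [D] the restricted measure agrees with [m], and
    on the complement it is zero. *)
Lemma ge0_integral_mrestr d (T : measurableType d)
    (m : {measure set T -> \bar R}) (D : set T) (mD : measurable D)
    (f : T -> \bar R) : measurable_fun setT f -> (forall x, 0 <= f x) ->
  \int[mrestr m mD]_x f x = \int[m]_(x in D) f x.
Proof.
move=> mf f0; rewrite -(setUv D) ge0_integral_setU//=; last 3 first.
- exact: measurableC.
- by rewrite setUv.
- by rewrite disj_set2E setICr.
rewrite [X in _ + X](_ : _ = 0) ?adde0.
  by apply: eq_measure_integral => A mA AD; rewrite /= /mrestr setIidl.
rewrite (@eq_measure_integral _ _ _ _ mzero); last first.
  move=> A mA AD; rewrite /= /mrestr/= /mzero.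
  rewrite (_ : A `&` D = set0) ?measure0//.
  by apply/seteqP; split => // x [/AD].
by rewrite integral_measure_zero.
Qed.

(* Testing on intervals suffices, as they generate the Borel sets; the right
   hand side is the integral of [g] for the first marginal of the area under
   the graph of [w]. *)
Lemma ge0_change_of_variables (D : set R) (chi w : R -> R) :
  measurable D -> measurable_fun setT chi ->
  measurable_fun setT w -> (forall t, 0 <= w t)%R ->
  (forall a b, (a < b)%R ->
    mu (D `&` chi @^-1` `]a, b]) = \int[mu]_(t in `]a, b]) (w t)%:E) ->
  (forall a b, (a < b)%R -> mu (D `&` chi @^-1` `]a, b]) < +oo) ->
  forall g : R -> \bar R, measurable_fun setT g -> (forall t, 0 <= g t) ->
  \int[mu]_(u in D) g (chi u) = \int[mu]_t (g t * (w t)%:E).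
Proof.
move=> mD mchi mw w0 Dw Dfin g mg g0.
pose T2 : measurableType _ := (measurableTypeR R * measurableTypeR R)%type.
pose S : set T2 := [set z | (0 <= z.2 < w z.1)%R].
have mS : measurable S.
  rewrite [S](_ : _ = [set z | (0 <= z.2)%R] `&` [set z | (z.2 < w z.1)%R]);
    last by apply/seteqP; split => z /=; [move=> /andP|move=> ?; apply/andP].
  apply: measurableI; rewrite -[X in measurable X]setTI.
    exact: (@measurable_fun_ler _ T2 _ setT (cst 0%R) snd).
  apply: (@measurable_fun_ltr _ T2 _ setT snd (w \o fst)) => //.
  exact: measurableT_comp.
pose m2 := (mu \x mu)%E.
have xS t : mu (xsection S t) = (w t)%:E.
  rewrite (_ : xsection S t = `[0%R, w t[%classic); last first.
    by apply/seteqP; split => y; rewrite /xsection/= inE /= in_itv.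
  rewrite lebesgue_measure_itv/= lte_fin; case: ltP => [_|]; first by rewrite sube0.
  by move=> wt; rewrite (@le_anti _ _ (w t) 0%R)// wt w0.
have mfst : measurable_fun setT (fst : T2 -> measurableTypeR R) by [].
(* [nu1] is the image under [chi] of Lebesgue measure on [D], and [nu2] the first marginal of the
   area measure on [S]. Equality of the two is the whole claim. *)
pose nu1 := measure_function_pushforward__canonical__measure_function_Measure
  (mrestr mu mD) (mchi : measurable_fun setT (chi : measurableTypeR R -> measurableTypeR R)).
pose nu2 := measure_function_pushforward__canonical__measure_function_Measure
  (mrestr m2 mS) mfst.
have nu2E A : measurable A -> nu2 A = \int[mu]_(t in A) (w t)%:E.
  move=> mA; rewrite /nu2 /pushforward /mrestr/= /m2 /product_measure1/=.
  rewrite [RHS]integral_mkcond; apply: eq_integral => t _ /=.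
  rewrite patchE; case: ifPn => tA.
    rewrite -xS; congr (mu _); apply/seteqP; split => y; rewrite /xsection/= !inE/=.
      by case.
    by move=> ?; split=> //; rewrite inE in tA.
  rewrite (_ : xsection _ _ = set0) ?measure0//.
  by apply/seteqP; split => y //; rewrite /xsection/= inE/= => -[] ?; rewrite notin_setE in tA.
have nuE A : measurable A -> nu1 A = nu2 A.
  apply: (@measure_unique _ R (measurableTypeR R) (@ocitv R)
    (fun n => `](- n%:R)%R, (n%:R : R)%R]%classic) erefl (@ocitvI R) _ _
    nu1 nu2).
  - by move=> n; exact: is_ocitv.
  - rewrite -subTset => x _ /=.
    exists (Num.bound `|x|%R) => //=.
    by have := archi_boundP (normr_ge0 x); rewrite ltr_norml in_itv/= => /andP[-> /ltW].
  - move=> B /ocitvP[->|[[a b] /= ab ->]]; first by rewrite !measure0.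
    by rewrite nu2E// -(Dw _ _ ab) setIC.
  - move=> n; change (mu (chi @^-1` `](- n%:R)%R, (n%:R)%R]%classic `&` D) < +oo); rewrite setIC.
    (* [Dfin] speaks of nondegenerate intervals only, so the empty interval at index 0 is set
       apart. *)
    have [->|n0] := eqVneq n 0%N.
      by rewrite mulr0n oppr0 set_itvoc0 preimage_set0 setI0 measure0.
    by apply: Dfin; rewrite -subr_gt0 opprK -natrD ltr0n addn_gt0 lt0n n0.
transitivity (\int[nu1]_t g t).
  rewrite ge0_integral_pushforward//= preimage_setT.
  rewrite ge0_integral_mrestr//; first exact: measurableT_comp.
transitivity (\int[nu2]_t g t).
  by apply: eq_measure_integral => A mA _; exact: nuE.
rewrite ge0_integral_pushforward//= preimage_setT.
rewrite ge0_integral_mrestr//=; last exact: measurableT_comp.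
rewrite integral_mkcond.
rewrite fubini_tonelli1/=; last 2 first.
  - apply/(measurable_restrictT _ mS)/measurable_funTS.
    exact: measurableT_comp.
  - by move=> z; rewrite patchE; case: ifP.
(* The section of [S] at [t] has length [w t], and [g t] is constant along it. *)
apply: eq_integral => t _; rewrite /fubini_F/=.
rewrite -xS -integral_cst//=; last by apply: measurable_xsection.
rewrite [RHS]integral_mkcond; apply: eq_integral => y _.
by rewrite !patchE mem_xsection.
Qed.

Lemma ftc_itvoc (F f : R -> R) (a b : R) : (a < b)%R ->
  (forall x : R, is_derive x 1%R F (f x)) -> continuous f ->
  \int[mu]_(x in `]a, b]) (f x)%:E = (F b - F a)%:E.
Proof.
move=> ab dF cf.
have cF : continuous F.
  by move=> x; apply/differentiable_continuous/derivable1_diffP; case: (dF x).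
rewrite integral_itv_obnd_cbnd; last first.
  by apply/measurable_EFinP/measurable_funTS; exact: continuous_measurable_fun.
rewrite (@continuous_FTC2 _ f F)//.
- exact: continuous_subspaceT.
- split; first by move=> x _; case: (dF x).
  + by apply: cvg_at_right_filter; exact: cF.
  + by apply: cvg_at_left_filter; exact: cF.
- by move=> x _; rewrite derive1E; case: (dF x).
Qed.

(** [|c|] times the image of Lebesgue measure under the affine map gives every half-open interval
    its length, so it is Lebesgue measure. *)
Lemma ge0_integral_affine (c d : R) (g : R -> \bar R) : c != 0%R ->
  measurable_fun setT g -> (forall t, 0 <= g t) ->
  `|c|%:E * \int[mu]_x g (c * x + d)%R = \int[mu]_x g x.
Proof.
move=> c0 mg g0.
pose f (x : measurableTypeR R) : measurableTypeR R := (c * x + d)%R.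
have mf : measurable_fun setT f.
  apply: measurable_funD; last exact: measurable_cst.
  exact: mulrl_measurable.
pose k := NngNum (normr_ge0 c).
pose nu := measure_function_pushforward__canonical__measure_function_Measure
  mu mf.
transitivity (\int[mscale k nu]_x g x).
  by rewrite ge0_integral_mscale// ge0_integral_pushforward.
apply: eq_measure_integral => A mA _; apply/esym.
apply: (@lebesgue_measure_unique R (mscale k nu)) => // _ [[a b]] _ <- /=.
rewrite /mscale/= /pushforward.
have [c_lt0|c_gt0] : (c < 0 \/ 0 < c)%R by apply/orP; rewrite -neq_lt.
(* A negative slope reverses the interval, so the preimage is closed on the left. *)
- rewrite (_ : f @^-1` _ = `[((b - d) / c)%R, ((a - d) / c)%R[%classic); last first.
    apply/seteqP; split => x /=; rewrite !in_itv/= /f.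
      move=> /andP[h1 h2]; rewrite ler_ndivrMr// ltr_ndivlMr//.
      by rewrite (mulrC x) lerBrDr ltrBlDr h1 h2.
    move=> /andP[]; rewrite ler_ndivrMr// ltr_ndivlMr// (mulrC x).
    by rewrite lerBrDr ltrBlDr => -> ->.
  rewrite !lebesgue_measure_itv/= !lte_fin ltr_ndivlMr// divfK// ltrD2r.
  case: ifP => _; last by rewrite mule0.
  by rewrite ltr0_norm// -!EFinB -EFinM; congr EFin; field; exact: c0.
- rewrite (_ : f @^-1` _ = `]((a - d) / c)%R, ((b - d) / c)%R]%classic); last first.
    apply/seteqP; split => x /=; rewrite !in_itv/= /f.
      move=> /andP[h1 h2]; rewrite ler_pdivlMr// ltr_pdivrMr//.
      by rewrite (mulrC x) lerBrDr ltrBlDr h1 h2.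
    move=> /andP[]; rewrite ler_pdivlMr// ltr_pdivrMr// (mulrC x).
    by rewrite lerBrDr ltrBlDr => -> ->.
  rewrite !lebesgue_measure_itv/= !lte_fin ltr_pdivlMr// divfK// ltrD2r.
  case: ifP => _; last by rewrite mule0.
  by rewrite gtr0_norm// -!EFinB -EFinM; congr EFin; field; exact: c0.
Qed.

Lemma is_derive_sqrt_addsqr (Q t : R) : (0 < Q)%R ->
  is_derive t 1%R (fun s : R => Num.sqrt (Q + s ^+ 2))
    (t / Num.sqrt (Q + t ^+ 2))%R.
Proof.
move=> Q0.
have Qt : (0 < Q + t ^+ 2)%R by rewrite ltr_pwDl// sqr_ge0.
have dsqrt := is_derive1_sqrt Qt.
have dQ : is_derive t (1 : R)%R (fun s : R => Q + s ^+ 2)%R (2 * t)%R.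
  apply: is_derive_eq; rewrite add0r /=.
  by rewrite /GRing.scale/= mulr1 mul1r mulr_natl mulr2n.
have := @is_derive1_comp _ _ (fun s : R => Q + s ^+ 2)%R _ _ _ dsqrt dQ.
move=> H; apply: is_derive_eq H _.
have : Num.sqrt (Q + t ^+ 2) != 0%R by rewrite gt_eqF// sqrtr_gt0.
by move=> ?; field.
Qed.

Lemma continuous_sqrt_addsqr (Q : R) : continuous (fun s : R => Num.sqrt (Q + s ^+ 2)).
Proof.
move=> x; apply: continuous_comp; last exact: sqrt_continuous.
by apply: cvgD; [exact: cvg_cst|exact: exprn_continuous].
Qed.

(** The substitution r = sqrt (Q + t^2). [ge0_change_of_variables] is applied to the inverse map
    [chi], with the derivative of r in t as weight [w]. *)
Lemma ge0_integral_sqrt_addsqr (Q : R) (g : R -> \bar R) : (0 <= Q)%R ->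
  measurable_fun setT g -> (forall t, 0 <= g t) ->
  \int[mu]_(t in `]0%R, +oo[) g (Num.sqrt (Q + t ^+ 2)) =
  \int[mu]_(r in `]Num.sqrt Q, +oo[) (g r * (r / Num.sqrt (r ^+ 2 - Q))%:E).
Proof.
rewrite le_eqVlt => /predU1P[<-|Q0] mg g0.
  rewrite sqrtr0; apply: eq_integral => t; rewrite inE/= in_itv/= andbT => t0.
  by rewrite add0r subr0 sqrtr_sqr gtr0_norm// divff ?gt_eqF// mule1.
have msq : measurable_fun setT (fun t : R => Num.sqrt (Q + t ^+ 2)).
  by apply: continuous_measurable_fun; exact: continuous_sqrt_addsqr.
have mmax : measurable_fun setT (fun t : R => Num.max t 0)%R by exact: measurable_maxr.
(* [G] is the left integrand divided by the weight, so that [G * w] gives it back for t > 0; the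
   maximum with 0 makes both factors vanish for t <= 0. *)
pose G t := g (Num.sqrt (Q + t ^+ 2)) * (Num.sqrt (Q + t ^+ 2) / Num.max t 0)%:E.
pose w t := (Num.max t 0 / Num.sqrt (Q + t ^+ 2))%R.
pose chi (r : R) := Num.sqrt (r ^+ 2 - Q).
have mw : measurable_fun setT w.
  by apply: measurable_realfun.measurable_funM => //; exact: measurable_funV.
have mG : measurable_fun setT G.
  apply: emeasurable_funM; first exact: measurableT_comp.
  apply/measurable_EFinP/measurable_realfun.measurable_funM => //.
  exact: measurable_funV.
have G0 t : 0 <= G t.
  by rewrite mule_ge0// lee_fin divr_ge0// le_max lexx orbT.
have w0 t : (0 <= w t)%R by rewrite divr_ge0// le_max lexx orbT.
have mchi : measurable_fun setT chi.
  by apply: measurable_sqrt; exact: measurable_funB.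
have Qt t : (0 < Q + t ^+ 2)%R by rewrite ltr_pwDl// sqr_ge0.
have chi_gt0 r : (Num.sqrt Q < r)%R -> (0 < chi r)%R.
  move=> Qr; rewrite sqrtr_gt0 subr_gt0 -(sqr_sqrtr (ltW Q0)).
  by rewrite ltr_pXn2r ?nnegrE// ?sqrtr_ge0// (le_trans _ (ltW Qr)).
have chiK r : (Num.sqrt Q < r)%R -> Num.sqrt (Q + chi r ^+ 2) = r.
  move=> Qr; have := chi_gt0 _ Qr; rewrite sqrtr_gt0 => /ltW h.
  rewrite sqr_sqrtr// addrC subrK sqrtr_sqr ger0_norm//.
  by rewrite (le_trans _ (ltW Qr)).
transitivity (\int[mu]_t (G t * (w t)%:E)).
  rewrite integral_mkcond; apply: eq_integral => t _; rewrite patchE /G /w.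
  rewrite mem_setE in_itv/= andbT; case: ltP => t0.
    rewrite -muleA -EFinM.
    rewrite mulrA divfK ?gt_eqF// divff ?mule1//.
    by rewrite gt_eqF// sqrtr_gt0.
  by rewrite mul0r mule0.
(* Since [chi] is positive beyond [sqrt Q], negative endpoints can be raised to 0; on t >= 0 the map
   t |-> sqrt (Q + t^2) inverts [chi] and is increasing. *)
have Dchi (a b : R) : (a < b)%R -> `]Num.sqrt Q, +oo[ `&` chi @^-1` `]a, b] =
    `](Num.sqrt (Q + Num.max a 0 ^+ 2))%R, (Num.sqrt (Q + Num.max b 0 ^+ 2))%R]%classic.
  move=> ab; have max0 (c : R) : (0 <= Num.max c 0)%R by rewrite le_max lexx orbT.
  have lt_chi (r c : R) : (Num.sqrt Q < r)%R ->
      (Num.sqrt (Q + Num.max c 0 ^+ 2) < r)%R = (c < chi r)%R.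
    move=> Qr; rewrite -{1}(chiK r Qr) ltr_sqrt// ltrD2l.
    rewrite ltr_pXn2r ?nnegrE ?max0 ?(ltW (chi_gt0 _ Qr))//.
    by rewrite gt_max chi_gt0// andbT.
  have Qle (c : R) : (Num.sqrt Q <= Num.sqrt (Q + Num.max c 0 ^+ 2))%R.
    by rewrite ler_wsqrtr// lerDl sqr_ge0.
  apply/seteqP; split => r /=; rewrite !in_itv/= ?andbT.
    by move=> [Qr] /andP[h1 h2]; rewrite lt_chi// h1/= leNgt lt_chi// -leNgt.
  move=> /andP[ar rb]; have Qr := le_lt_trans (Qle a) ar.
  by split => //; rewrite -lt_chi// ar/= leNgt -lt_chi// -leNgt.
rewrite -(@ge0_change_of_variables `]Num.sqrt Q, +oo[%classic chi)//.
- apply: eq_integral => r; rewrite inE/= in_itv/= andbT => Qr.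
  by rewrite /G chiK// (max_idPl _)// ltW// chi_gt0.
- move=> a b ab; rewrite Dchi// lebesgue_measure_itv/= lte_fin.
  have [b0|b0] := leP b 0%R.
    rewrite (max_idPr (le_trans (ltW ab) b0)) ltxx integral0_eq// => x/=.
    rewrite in_itv/= => /andP[_ xb].
    by rewrite /w (max_idPr (le_trans xb b0)) mul0r.
  have a'b : (Num.max a 0 < b)%R by rewrite gt_max ab.
  have max0 : (0 <= Num.max a 0)%R by rewrite le_max lexx orbT.
  rewrite ltr_sqrt// ltrD2l ltr_pXn2r ?nnegrE ?max0 ?(ltW b0)// a'b.
  (* The weight vanishes for t <= 0, so the integral may start at [max a 0], beyond which [w] is the
     derivative of sqrt (Q + t^2). *)
  transitivity (\int[mu]_(t in `]Num.max a 0%R, b]) (t / Num.sqrt (Q + t ^+ 2))%:E).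
    apply/esym/(ftc_itvoc a'b (fun t => is_derive_sqrt_addsqr t Q0)) => x.
    apply: cvgM; first exact: cvg_id.
    apply: cvgV; first by rewrite gt_eqF// sqrtr_gt0.
    exact: continuous_sqrt_addsqr.
  rewrite integral_mkcond [RHS]integral_mkcond; apply: eq_integral => t _.
  rewrite !patchE !mem_setE !in_itv/= gt_max /w.
  have [t0|t0] := leP t 0%R; last by rewrite andbT.
  by rewrite andbF/= mul0r if_same.
- move=> a b ab; rewrite Dchi// lebesgue_measure_itv/=.
  by case: ifP => //; rewrite -EFinB ltry.
Qed.

(** With t = u / sqrt (1 - u^2) the integrand becomes sqrt (1 + t^2) and du = (1 + t^2)^(-3/2) dt,
    which leaves the integral of 1 / (1 + t^2) over the line. *)
Lemma integral_arcsine : \int[mu]_(u in `](-1)%R, 1%R[) (Num.sqrt (1 - u ^+ 2))^-1%:E = pi%:E.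
Proof.
pose sq (t : R) := Num.sqrt (1 + t ^+ 2).
pose w t := ((sq t) ^- 3)%R.
(* [F] is the inverse of [chi], and [w] is its derivative. *)
pose F (t : R) := (t / sq t)%R.
pose chi (u : R) := (u / Num.sqrt (1 - u ^+ 2))%R.
have Qt (t : R) : (0 < 1 + t ^+ 2)%R by rewrite ltr_pwDl// sqr_ge0.
have sq0 t : (0 < sq t)%R by rewrite sqrtr_gt0.
have sqn t : sq t != 0%R by rewrite gt_eqF.
have csq : continuous sq by exact: continuous_sqrt_addsqr.
have dF t : is_derive t (1 : R)%R F (w t).
  have dsq : is_derive t (1 : R)%R sq (t / sq t)%R by exact: is_derive_sqrt_addsqr.
  have dV := is_deriveV (sqn t) dsq.
  have := is_deriveM (is_derive_id t (1 : R)%R) dV.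
  move=> H; apply: is_derive_eq H _.
  rewrite /GRing.scale/= /w !mulr1.
  have -> : (t * (- sq t ^- 2 * (t / sq t)) + (sq t)^-1 = (sq t ^+ 2 - t ^+ 2) / sq t ^+ 3)%R by field; exact: sqn.
  by rewrite sqr_sqrtr ?ltW// addrK mul1r.
have cw : continuous w.
  move=> x; apply: cvgV; first by rewrite expf_neq0.
  apply: (@continuous_comp _ _ _ sq (fun y : R => y ^+ 3)%R); first exact: csq.
  exact: exprn_continuous.
have u1 (u : R) : (-1 < u < 1)%R -> (0 < 1 - u ^+ 2)%R.
  by move=> ?; nra.
have chi_sq (u : R) : (-1 < u < 1)%R -> sq (chi u) = ((Num.sqrt (1 - u ^+ 2))^-1)%R.
  move=> /u1 u0; have s0 := sqrtr_gt0 (1 - u ^+ 2); rewrite u0 in s0.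
  rewrite -[RHS]gtr0_norm ?invr_gt0// -[RHS]sqrtr_sqr; congr Num.sqrt.
  rewrite exprVn sqr_sqrtr ?(ltW u0)// /chi expr_div_n sqr_sqrtr ?(ltW u0)//.
  by field; rewrite gt_eqF.
have chiK (u : R) : (-1 < u < 1)%R -> F (chi u) = u.
  move=> u1'; rewrite /F chi_sq// invrK /chi divfK// gt_eqF// sqrtr_gt0.
  exact: u1.
have F1 (t : R) : (-1 < F t < 1)%R.
  rewrite -ltr_norml normrM normfV ltr_pdivrMr ?normr_gt0// mul1r.
  by rewrite -sqrtr_sqr [ltRHS]gtr0_norm// ltr_sqrt// ltrDr.
have Fincr : {mono F : x y / (x < y)%R}.
  apply: leW_mono; apply: le_mono => x y xy.
  apply: (@gtr0_derive1_incr _ F x y) => //.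
  - move=> z _; rewrite derive1E; case: (dF z) => _ ->.
    by rewrite invr_gt0 exprn_gt0.
  - apply: continuous_subspaceT => z.
    by apply/differentiable_continuous/derivable1_diffP; case: (dF z).
have Dchi (a b : R) : `](-1)%R, 1%R[ `&` chi @^-1` `]a, b] = `]F a, F b]%classic.
  apply/seteqP; split => u /=; rewrite !in_itv/=.
    by move=> [u1'] /andP[h1 h2]; rewrite -(chiK u)// Fincr leNgt Fincr -leNgt h1.
  move=> /andP[h1 h2]; have u1' : (-1 < u < 1)%R.
    have /andP[? _] := F1 a; have /andP[_ ?] := F1 b.
    by rewrite (lt_trans _ h1)// (le_lt_trans h2).
  by split=> //; apply/andP; split; [|rewrite leNgt]; rewrite -Fincr chiK// -leNgt.
transitivity (\int[mu]_t ((sq t)%:E * (w t)%:E)).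
  rewrite -(@ge0_change_of_variables `](-1)%R, 1%R[%classic chi w)//.
  - by apply: eq_integral => u; rewrite inE/= in_itv/= => u1'; rewrite chi_sq.
  - apply: measurable_realfun.measurable_funM => //.
    by apply/measurable_funV/measurable_sqrt/measurable_funB.
  - exact: continuous_measurable_fun.
  - by move=> t; rewrite invr_ge0 exprn_ge0// ltW.
  - move=> a b ab; rewrite Dchi lebesgue_measure_itv/= lte_fin Fincr ab.
    exact/esym/(ftc_itvoc ab dF).
  - move=> a b ab; rewrite Dchi lebesgue_measure_itv/=.
    by case: ifP => //; rewrite -EFinB ltry.
  - by apply/measurable_EFinP; exact: continuous_measurable_fun.
  - by move=> t; rewrite lee_fin ltW.
transitivity (\int[mu]_t (oneDsqr (t : R))^-1%:E).
  apply: eq_integral => t _; rewrite -EFinM /w; congr EFin.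
  rewrite /oneDsqr -(sqr_sqrtr (ltW (Qt t))) -/(sq t).
  by field; exact: sqn.
rewrite (@ge0_symfun_integralT R (fun t => (oneDsqr t)^-1)%R)//.
- rewrite -set_itvcy integral0y_oneDsqr -EFinM; congr EFin; by field.
- exact: continuous_oneDsqrV.
- by move=> x; rewrite /oneDsqr/= sqrrN.
Qed.

End change_of_variables.

(** * Volume of a solid cone *)

Section cone_integral.
Context (R : realType).
Local Notation mu := (@lebesgue_measure R).
Local Notation mu2 := (mu \x mu)%E.
Local Open Scope ereal_scope.

(** The radius determines the coordinate w only up to sign, so the line is folded onto a half-line
    before r replaces w. *)
Lemma ge0_integral_even (f : R -> \bar R) : measurable_fun setT f ->
  (forall x, 0 <= f x) -> (forall x, f (- x)%R = f x) ->
  \int[mu]_x f x = 2%:E * \int[mu]_(x in `]0%R, +oo[) f x.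
Proof.
move=> mf f0 fN.
have mfD D : measurable_fun D f by exact: measurable_funTS.
rewrite -(setUv `]0%R, +oo[%classic) setCitvr ge0_integral_setU//=.
- have := ge0_integration_by_substitution0 mf f0.
  under [X in _ = X]eq_integral do rewrite fN.
  move=> <-; rewrite -integral_itv_obnd_cbnd//.
  by rewrite mule_natl mule2n.
- exact: mfD.
- rewrite disj_set2E; apply/eqP; rewrite -subset0 => x/=.
  by rewrite !in_itv/= andbT ltNge => -[/negP].
Qed.

Lemma sigma_finite_lebesgue2 : sigma_finite setT (lebesgue2 R).
Proof.
pose I (n : nat) : set (measurableTypeR R) := `](- n%:R)%R, n%:R%R]%classic.
exists (fun n => I n `*` I n).
  apply/esym; rewrite -subTset => -[x y] _.
  have bnd (t : R) m : (Num.bound `|t|%R <= m)%N -> I m t.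
    rewrite -(ler_nat R) => tm.
    have := lt_le_trans (archi_boundP (normr_ge0 t)) tm.
    by rewrite ltr_norml /I/= in_itv/= => /andP[-> /ltW].
  exists (maxn (Num.bound `|x|%R) (Num.bound `|y|%R)) => //.
  by split; apply: bnd; rewrite ?leq_maxl ?leq_maxr.
move=> n; split; first by apply: measurableX; exact: measurable_itv.
have In : mu (I n) < +oo.
  by rewrite /I lebesgue_measure_itv/=; case: ifP => //; rewrite -EFinB ltry.
have -> : lebesgue2 R (I n `*` I n) = mu (I n) * mu (I n).
  by apply: product_measure1E; exact: measurable_itv.
by rewrite lte_mul_pinfty// ge0_fin_numE.
Qed.

(* The instance that inference finds on a product asks the factors to be
   subprobabilities. *)
Definition sf_lebesgue2 : {sigma_finite_measure set (Rplane R) -> \bar R} :=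
  HB.pack (Measure.sort (lebesgue2 R))
    (Measure_isSigmaFinite.Build _ _ _ (lebesgue2 R) sigma_finite_lebesgue2).

(** Each coordinate contributes a factor [|N|] through [ge0_integral_affine], and their product is
    [N ^+ 2]. *)
Lemma ge0_integral_scale2 (N : R) (h : Rplane R -> \bar R) : N != 0%R ->
  measurable_fun setT h -> (forall z, 0 <= h z) ->
  \int[mu2]_z h z = (N ^+ 2)%:E * \int[mu2]_z h (N * z.1, N * z.2)%R.
Proof.
move=> N0 mh h0.
have mN : measurable_fun setT (fun z : Rplane R => (N * z.1, N * z.2)%R : Rplane R).
  by apply: measurable_fun_pair => /=; apply: measurableT_comp => //.
rewrite [in RHS]fubini_tonelli1//; last exact: measurableT_comp.
rewrite [LHS]fubini_tonelli1// /fubini_F/=.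
rewrite -(@ge0_integral_affine _ N 0); last 3 first.
- by [].
- exact: measurable_fun_fubini_tonelli_F.
- by move=> t; exact: integral_ge0.
rewrite -real_normK ?num_real// expr2 EFinM -muleA; congr (_ * _).
rewrite -ge0_integralZl//=; last 2 first.
- apply: (measurable_fun_fubini_tonelli_F (fun z : Rplane R => h (N * z.1, N * z.2)%R)).
    exact: (measurableT_comp mh mN).
  by move=> z.
- by move=> x _; exact: integral_ge0.
apply: eq_integral => x _.
rewrite -(@ge0_integral_affine _ N 0 (fun y => h ((N * x + 0)%R, y)))//.
  by congr (_ * _); apply: eq_integral => y _; rewrite !addr0.
exact: measurableT_comp.
Qed.

Variable Q : Rplane R -> R.
Hypothesis mQ : measurable_fun setT Q.
Hypothesis Q_ge0 : forall z, (0 <= Q z)%R.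
Hypothesis QZ : forall (N : R) z, Q (N * z.1, N * z.2)%R = (N ^+ 2 * Q z)%R.

(** The first two coordinates are meant as (a.y, b.y) and the third as n.y, so that [r] stands for
    the norm of y. *)
Definition solid_cone (B : set (Rplane R)) : set (Rspace R) :=
  [set x | let r := Num.sqrt (Q x.1 + x.2 ^+ 2) in
    (0 < r <= 1)%R /\ B (r^-1 * x.1.1, r^-1 * x.1.2)%R].

Lemma measurable_solid_cone B : measurable B -> measurable (solid_cone B).
Proof.
move=> mB.
pose rad (x : Rspace R) : measurableTypeR R := Num.sqrt (Q x.1 + x.2 ^+ 2).
have mrad : measurable_fun setT rad.
  apply: measurable_sqrt; apply: measurable_funD; first exact: measurableT_comp.
  exact: measurable_funX.
pose f x : measurableTypeR R * Rplane R :=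
  (rad x, ((rad x)^-1 * x.1.1, (rad x)^-1 * x.1.2)%R).
have mf : measurable_fun setT f.
  apply: measurable_fun_pair => //; apply: measurable_fun_pair => //=.
  - apply: measurable_realfun.measurable_funM; first exact: measurable_funV.
    exact: (measurableT_comp measurable_fst measurable_fst).
  - apply: measurable_realfun.measurable_funM; first exact: measurable_funV.
    exact: (measurableT_comp measurable_snd measurable_fst).
have mC : measurable (`]0%R, 1%R]%classic `*` B : set (measurableTypeR R * Rplane R)).
  exact: measurableX.
by have := mf measurableT _ mC; rewrite setTI; congr measurable.
Qed.

(** What matters is that [k] is the same for all [B]. Homogeneity of [Q] separates the radius,
    collected in [k], from the position u = z / r. *)
Lemma lebesgue3_solid_cone : exists k : \bar R,
  forall B, measurable B -> lebesgue3 R (solid_cone B) =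
    k * \int[lebesgue2 R]_(z in B) (Num.sqrt (1 - Q z))^-1%:E.
Proof.
pose c (r : R) : R := \1_(`]0%R, 1%R]%classic) r.
(* The 2 counts the signs of w; r^2 is the Jacobian of z = r u at fixed r, and [c] restricts to 0 <
   r <= 1. *)
exists (2%:E * \int[mu]_r (c r * r ^+ 2)%:E) => B mB.
pose u (z : Rplane R) (r : R) : Rplane R := (r^-1 * z.1, r^-1 * z.2)%R.
pose g z (r : R) : R := (c r * \1_B (u z r))%R.
pose H (zr : Rplane R * measurableTypeR R) : \bar R :=
  (g zr.1 zr.2 * (zr.2 / Num.sqrt (zr.2 ^+ 2 - Q zr.1)))%:E.
have mc : measurable_fun setT c by exact: measurable_indic.
have mg : measurable_fun setT (fun zr : Rplane R * measurableTypeR R => g zr.1 zr.2).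
  apply: measurable_realfun.measurable_funM; first exact: measurableT_comp.
  apply: (measurableT_comp (measurable_indic mB)).
  by apply: measurable_fun_pair => /=; apply: measurable_realfun.measurable_funM;
    [exact: measurable_funV|exact: measurableT_comp|exact: measurable_funV|exact: measurableT_comp].
have g0 z r : (0 <= g z r)%R by rewrite mulr_ge0.
have H0 z : 0 <= H z.
  rewrite lee_fin /g /c indicE mem_setE in_itv/=.
  have [/andP[z0 _]|_] := boolP (0 < z.2 <= 1)%R; last by rewrite !mul0r.
  by rewrite mul1r mulr_ge0// divr_ge0// ltW.
have mH : measurable_fun setT H.
  apply/measurable_EFinP/measurable_realfun.measurable_funM => //.
  apply: measurable_realfun.measurable_funM => //.
  apply/measurable_funV/measurable_sqrt/measurable_funB.
    exact: measurable_funX.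
  exact: measurableT_comp.
have mgz z : measurable_fun setT (fun r => (g z r)%:E).
  by apply/measurable_EFinP; exact: (measurableT_comp mg (pair1_measurable z)).
transitivity (\int[mu2]_z (2%:E * \int[mu]_r H (z, r))).
  change (\int[mu2]_z mu (xsection (solid_cone B) z) =
    \int[mu2]_z (2%:E * \int[mu]_r H (z, r))).
  apply: eq_integral => z _.
  transitivity (\int[mu]_t (g z (Num.sqrt (Q z + t ^+ 2)))%:E).
    rewrite -[xsection _ _]setIT -integral_indic//; last first.
      by apply: measurable_xsection; exact: measurable_solid_cone.
    apply: eq_integral => t _; congr EFin.
    rewrite indicE mem_xsection /g /c !indicE -natrM mulnb; congr (nat_of_bool _)%:R.
    apply/idP/andP => [|[]]; rewrite !inE/= in_itv/=; first by case.
    by move=> ? ?; split.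
  rewrite ge0_integral_even; last 3 first.
  - apply: (measurableT_comp (mgz z)).
    by apply: continuous_measurable_fun; exact: continuous_sqrt_addsqr.
  - by move=> t; rewrite lee_fin.
  - by move=> t; rewrite sqrrN.
  rewrite (@ge0_integral_sqrt_addsqr _ _ (fun r => (g z r)%:E))//; last by move=> t; rewrite lee_fin.
  congr (_ * _); rewrite integral_mkcond; apply: eq_integral => r _.
  rewrite patchE mem_setE in_itv/= andbT /H/= -EFinM.
  have [//|rQ] := ltP; congr EFin.
  have [r0|r0] := leP r 0%R.
    by rewrite /g /c indicE mem_setE in_itv/= ltNge r0/= !mul0r.
  rewrite (@ler0_sqrtr _ (r ^+ 2 - Q z)) ?invr0 ?mulr0//.
  rewrite subr_le0 -(sqr_sqrtr (Q_ge0 z)).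
  by rewrite ler_pXn2r ?nnegrE// ?sqrtr_ge0// ltW.
rewrite (@ge0_integralZl _ _ _ mu2 _ _ (fubini_F mu H))//; last 2 first.
- exact: measurable_fun_fubini_tonelli_F.
- by move=> z _; exact: integral_ge0.
rewrite -muleA; congr (_ * _).
(* The order of integration is exchanged, so that z can be rescaled while r is fixed. *)
rewrite -(@fubini_tonelli1 _ _ _ _ _ sf_lebesgue2 mu H)// (@fubini_tonelli2 _ _ _ _ _ sf_lebesgue2 mu H)//.
rewrite -ge0_integralZr//; last 3 first.
- by apply/measurable_EFinP/measurable_realfun.measurable_funM.
- move=> r _; rewrite lee_fin mulr_ge0// ?sqr_ge0//.
- by apply: integral_ge0 => z _; rewrite lee_fin.
apply: eq_integral => r _.
have [r01|r01] := boolP (r \in `]0%R, 1%R]%classic); last first.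
  rewrite /c indicE (negbTE r01) mul0r mul0e.
  by apply: integral0_eq => z _; rewrite /H/g/c/= indicE (negbTE r01) !mul0r.
rewrite [LHS](_ : _ = \int[mu2]_z H (z, r))//.
have c1 : c r = 1%R by rewrite /c indicE r01.
move: r01; rewrite inE/= in_itv/= c1 mul1r => /andP[r0 r1].
rewrite (@ge0_integral_scale2 r (fun z => H (z, r))); last 3 first.
- by rewrite gt_eqF.
- exact: measurableT_comp.
- by move=> z; exact: H0 (z, r).
congr (_ * _); rewrite [RHS]integral_mkcond; apply: eq_integral => z _.
rewrite /H /g/= patchE indicE; have -> : u (r * z.1, r * z.2)%R r = z.
  by rewrite /u/= !mulKf ?gt_eqF//; case: z.
case: ifPn => zB; last by rewrite mulr0 mul0r.
(* By homogeneity r / sqrt (r^2 - Q (r u)) = 1 / sqrt (1 - Q u), which is free of r. *)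
rewrite c1 !mul1r QZ -[X in (X - _)%R]mulr1 -mulrBr sqrtrM ?sqr_ge0//.
by rewrite sqrtr_sqr gtr0_norm// invfM mulVKf// gt_eqF.
Qed.
End cone_integral.

(** * Linear maps and volume in dimension three *)

Section linear_image.
Context (R : realType).
Local Notation mu := (@lebesgue_measure R).
Local Open Scope ereal_scope.

Lemma lebesgue_measure_affine (c d : R) (A : set R) : c != 0%R -> measurable A ->
  mu [set x | A (c * x + d)%R] = (`|c|^-1)%:E * mu A.
Proof.
move=> c0 mA.
have mf : measurable_fun setT (fun x : R => c * x + d)%R by exact: measurable_funD.
have m1 : measurable_fun setT (fun t : R => (\1_A t)%:E : \bar R).
  by apply/measurable_EFinP; exact: measurable_indic.
have g0 (t : R) : 0 <= (\1_A t)%:E :> \bar R by rewrite lee_fin.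
have := ge0_integral_affine d c0 m1 g0.
rewrite [X in _ = X -> _]integral_indic// setIT => <-.
rewrite muleA -EFinM mulVf ?normr_eq0// mul1e.
rewrite [RHS](_ : _ = \int[mu]_x (\1_[set x | A (c * x + d)%R] x)%:E)//.
by rewrite integral_indic// ?setIT//; rewrite -[X in measurable X]setTI; exact: mf.
Qed.

(** On every fibre over the first coordinate the map is affine with slope [c]; only the translation
    depends on the fibre, and it preserves length. *)
Lemma product_lebesgue_shear d (T : measurableType d) (m : {measure set T -> \bar R})
    (c : R) (e : T -> R) (S : set (T * measurableTypeR R)) : c != 0%R ->
  measurable_fun setT e -> measurable S ->
  (m \x mu) [set z | S (z.1, c * z.2 + e z.1)%R] = (`|c|^-1)%:E * (m \x mu) S.
Proof.
move=> c0 me mS.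
rewrite -[RHS]ge0_integralZl//; last exact: measurable_fun_xsection.
apply: eq_integral => z _.
rewrite -(lebesgue_measure_affine (e z) c0); last exact: measurable_xsection.
by congr (mu _); apply/seteqP; split => t; rewrite /xsection/= !inE.
Qed.

(** The product measure is defined by slicing along the first factor. Slicing along the second gives
    the same values on rectangles, hence the same measure. *)
Lemma product_measure_ysectionE d1 d2 (T1 : measurableType d1) (T2 : measurableType d2)
    (m1 : {sigma_finite_measure set T1 -> \bar R})
    (m2 : {sigma_finite_measure set T2 -> \bar R}) (S : set (T1 * T2)) :
  measurable S -> (m1 \x m2) S = \int[m2]_t m1 (ysection S t).
Proof.
move=> mS; apply: (@product_measure_unique _ _ _ _ _ m1 m2 (m1 \x^ m2)%E) => //.
by move=> A B mA mB; exact: product_measure2E.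
Qed.

Lemma lebesgue_shear_product d (T : measurableType d)
    (m : {sigma_finite_measure set T -> \bar R})
    (c : R) (e : T -> R) (S : set (measurableTypeR R * T)) : c != 0%R ->
  measurable_fun setT e -> measurable S ->
  (mu \x m) [set z | S (c * z.1 + e z.2, z.2)%R] = (`|c|^-1)%:E * (mu \x m) S.
Proof.
move=> c0 me mS.
have mS' : measurable [set z : measurableTypeR R * T | S (c * z.1 + e z.2, z.2)%R].
  rewrite -[X in measurable X]setTI.
  suff : measurable_fun setT
    (fun z : measurableTypeR R * T => (c * z.1 + e z.2, z.2)%R : measurableTypeR R * T).
    exact.
  apply: measurable_fun_pair => //; apply: measurable_funD; exact: measurableT_comp.
rewrite !product_measure_ysectionE//.
rewrite -ge0_integralZl//; last exact: measurable_fun_ysection.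
apply: eq_integral => z _.
rewrite -(lebesgue_measure_affine (e z) c0); last exact: measurable_ysection.
by congr (mu _); apply/seteqP; split => t; rewrite /ysection/= !inE.
Qed.

(** The factor stays existential because only proportionality of volumes is used later;
    measurability is included so that the property passes to compositions. *)
Definition scales_volume (f : Rspace R -> Rspace R) :=
  measurable_fun setT f /\ exists c : R, forall S, measurable S ->
    lebesgue3 R (f @^-1` S) = c%:E * lebesgue3 R S.

Lemma scales_volume_comp f g :
  scales_volume f -> scales_volume g -> scales_volume (f \o g).
Proof.
move=> [mf [c fc]] [mg [c' gc]]; split; first exact: measurableT_comp.
exists (c' * c)%R => S mS; rewrite comp_preimage gc; last first.
  by rewrite -[X in measurable X]setTI; exact: mf.
by rewrite fc// muleA EFinM.
Qed.

Lemma scales_volume_row3 (p q r : R) : r != 0%R ->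
  scales_volume (fun x => (x.1.1, x.1.2, p * x.1.1 + q * x.1.2 + r * x.2)%R).
Proof.
move=> r0.
have me : measurable_fun setT (fun z : Rplane R => p * z.1 + q * z.2)%R.
  by apply: measurable_funD; exact: measurableT_comp.
split.
  apply: measurable_fun_pair => /=.
    by apply: measurable_fun_pair => /=; apply: measurableT_comp.
  apply: measurable_funD; last exact: measurableT_comp.
  exact: (measurableT_comp me).
exists (`|r|^-1)%R => S mS.
rewrite -(product_lebesgue_shear (lebesgue2 R) r0 me mS).
by congr (lebesgue3 R _); apply/seteqP; split => -[[x y] z]/=; rewrite addrC.
Qed.

Lemma lebesgue3_ysectionE (S : set (Rspace R)) : measurable S ->
  lebesgue3 R S = \int[mu]_t lebesgue2 R (ysection S t).
Proof. exact: (product_measure_ysectionE (sf_lebesgue2 R) mu). Qed.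

(** The sheared coordinate is not the last factor of the product, so the set is sliced at a fixed
    third coordinate and each slice undergoes a planar shear. *)
Lemma scales_volume_row2 (p q r : R) : q != 0%R ->
  scales_volume (fun x => (x.1.1, p * x.1.1 + q * x.1.2 + r * x.2, x.2)%R).
Proof.
move=> q0; set f := (X in scales_volume X).
have mf : measurable_fun setT f.
  apply: measurable_fun_pair => //=; apply: measurable_fun_pair => /=.
    exact: measurableT_comp.
  apply: measurable_funD; last exact: measurableT_comp.
  apply: measurable_funD; apply: measurableT_comp => //; exact: measurableT_comp.
split=> //; exists (`|q|^-1)%R => S mS.
have mfS : measurable (f @^-1` S) by rewrite -[X in measurable X]setTI; exact: mf.
rewrite !lebesgue3_ysectionE//.
rewrite -ge0_integralZl//; last exact: (measurable_fun_ysection (sf_lebesgue2 R)).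
apply: eq_integral => t _.
have me : measurable_fun setT (fun x : measurableTypeR R => p * x + r * t)%R.
  exact: measurable_funD.
rewrite -(product_lebesgue_shear mu q0 me (measurable_ysection _ mS)).
congr (lebesgue2 R _); apply/seteqP; split => -[x y]/=; rewrite /ysection/= !inE /f/=.
  by rewrite addrAC [(_ + q * y)%R]addrC addrA.
by rewrite addrAC [(_ + q * y)%R]addrC addrA.
Qed.

Lemma scales_volume_row1 (p q r : R) : p != 0%R ->
  scales_volume (fun x => (p * x.1.1 + q * x.1.2 + r * x.2, x.1.2, x.2)%R).
Proof.
move=> p0; set f := (X in scales_volume X).
have mf : measurable_fun setT f.
  apply: measurable_fun_pair => //=; apply: measurable_fun_pair => /=; last first.
    exact: measurableT_comp.
  apply: measurable_funD; last exact: measurableT_comp.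
  apply: measurable_funD; apply: measurableT_comp => //; exact: measurableT_comp.
split=> //; exists (`|p|^-1)%R => S mS.
have mfS : measurable (f @^-1` S) by rewrite -[X in measurable X]setTI; exact: mf.
rewrite !lebesgue3_ysectionE//.
rewrite -ge0_integralZl//; last exact: (measurable_fun_ysection (sf_lebesgue2 R)).
apply: eq_integral => t _.
have me : measurable_fun setT (fun y : measurableTypeR R => q * y + r * t)%R.
  exact: measurable_funD.
rewrite -(lebesgue_shear_product mu p0 me (measurable_ysection _ mS)).
by congr (lebesgue2 R _); apply/seteqP; split => -[x y]/=; rewrite /ysection/= !inE /f/= addrA.
Qed.

End linear_image.

(** * Invertible matrices of size three *)

Section linear_map3.
Context (R : realType).
Implicit Types A B : 'M[R]_3.

Definition linear_map3 A (x : Rspace R) : Rspace R :=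
  ((A *m vec3 x) 0 0, (A *m vec3 x) 1 0, (A *m vec3 x) 2 0).

Lemma linear_map3E A x : linear_map3 A x =
  (A 0 0 * x.1.1 + A 0 1 * x.1.2 + A 0 2 * x.2,
   A 1 0 * x.1.1 + A 1 1 * x.1.2 + A 1 2 * x.2,
   A 2 0 * x.1.1 + A 2 1 * x.1.2 + A 2 2 * x.2).
Proof.
rewrite /linear_map3 !mxE !big_ord_recl !big_ord0 !mxE/= !addr0 !addrA.
rewrite (_ : lift ord0 ord0 = 1); last exact/val_inj.
by rewrite (_ : lift ord0 (lift ord0 ord0) = 2); last exact/val_inj.
Qed.

Lemma ord3P (P : 'I_3 -> Prop) : P 0 -> P 1 -> P 2 -> forall i, P i.
Proof.
move=> P0 P1 P2 [[|[|[|//]]] i3].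
- by rewrite (_ : Ordinal i3 = 0)//; exact/val_inj.
- by rewrite (_ : Ordinal i3 = 1)//; exact/val_inj.
- by rewrite (_ : Ordinal i3 = 2)//; exact/val_inj.
Qed.

Lemma vec3_linear_map3 A x : vec3 (linear_map3 A x) = A *m vec3 x.
Proof. by apply/colP; elim/ord3P; rewrite [LHS]mxE. Qed.

Lemma linear_map3M A B : linear_map3 (A *m B) = linear_map3 A \o linear_map3 B.
Proof. by apply/funext => x; rewrite /= /linear_map3 vec3_linear_map3 mulmxA. Qed.

(** Three row operations carried out from the bottom row up, so that each one still reads the
    original coordinates above it. *)
Lemma scales_volume_lower A : (forall i j : 'I_3, (i < j)%N -> A i j = 0) ->
  (forall i, A i i != 0) -> scales_volume (linear_map3 A).
Proof.
move=> A0 Ai.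
have -> : linear_map3 A = (fun x => (A 0 0 * x.1.1 + 0 * x.1.2 + 0 * x.2, x.1.2, x.2))
  \o ((fun x => (x.1.1, A 1 0 * x.1.1 + A 1 1 * x.1.2 + 0 * x.2, x.2))
  \o (fun x => (x.1.1, x.1.2, A 2 0 * x.1.1 + A 2 1 * x.1.2 + A 2 2 * x.2))).
  by apply/funext => x; rewrite linear_map3E/= (A0 0 1)// (A0 0 2)// (A0 1 2)// !mul0r.
apply: scales_volume_comp; first exact: scales_volume_row1.
by apply: scales_volume_comp; [exact: scales_volume_row2|exact: scales_volume_row3].
Qed.

(** Here the rows are replaced from the top down, for the same reason as in
    [scales_volume_lower]. *)
Lemma scales_volume_upper A : (forall i j : 'I_3, (j < i)%N -> A i j = 0) ->
  (forall i, A i i != 0) -> scales_volume (linear_map3 A).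
Proof.
move=> A0 Ai.
have -> : linear_map3 A = (fun x => (x.1.1, x.1.2, 0 * x.1.1 + 0 * x.1.2 + A 2 2 * x.2))
  \o ((fun x => (x.1.1, 0 * x.1.1 + A 1 1 * x.1.2 + A 1 2 * x.2, x.2))
  \o (fun x => (A 0 0 * x.1.1 + A 0 1 * x.1.2 + A 0 2 * x.2, x.1.2, x.2))).
  by apply/funext => x; rewrite linear_map3E/= (A0 1 0)// (A0 2 0)// (A0 2 1)// !mul0r !add0r.
apply: scales_volume_comp; first exact: scales_volume_row3.
by apply: scales_volume_comp; [exact: scales_volume_row2|exact: scales_volume_row1].
Qed.

(** A swap of two adjacent coordinates is a product of three row operations: (x, y) becomes (x + y,
    y), then (x + y, x), then (y, x). The swap of the outer two is a conjugate of these. *)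
Lemma scales_volume_tperm (i j : 'I_3) : i != j -> scales_volume (linear_map3 (tperm_mx i j)).
Proof.
have h01 : scales_volume (fun x : Rspace R => (x.1.2, x.1.1, x.2)).
  have -> : (fun x : Rspace R => (x.1.2, x.1.1, x.2)) =
      (fun x => (1 * x.1.1 + -1 * x.1.2 + 0 * x.2, x.1.2, x.2)) \o
      ((fun x => (x.1.1, 1 * x.1.1 + -1 * x.1.2 + 0 * x.2, x.2)) \o
      (fun x => (1 * x.1.1 + 1 * x.1.2 + 0 * x.2, x.1.2, x.2))).
    by apply/funext => -[[x y] z] /=; congr (_, _, _); ring.
  apply: scales_volume_comp; first exact/scales_volume_row1/oner_neq0.
  apply: scales_volume_comp; last exact/scales_volume_row1/oner_neq0.
  by apply: scales_volume_row2; rewrite oppr_eq0 oner_neq0.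
have h12 : scales_volume (fun x : Rspace R => (x.1.1, x.2, x.1.2)).
  have -> : (fun x : Rspace R => (x.1.1, x.2, x.1.2)) =
      (fun x => (x.1.1, 0 * x.1.1 + 1 * x.1.2 + -1 * x.2, x.2)) \o
      ((fun x => (x.1.1, x.1.2, 0 * x.1.1 + 1 * x.1.2 + -1 * x.2)) \o
      (fun x => (x.1.1, 0 * x.1.1 + 1 * x.1.2 + 1 * x.2, x.2))).
    by apply/funext => -[[x y] z] /=; congr (_, _, _); ring.
  apply: scales_volume_comp; first exact/scales_volume_row2/oner_neq0.
  apply: scales_volume_comp; last exact/scales_volume_row2/oner_neq0.
  by apply: scales_volume_row3; rewrite oppr_eq0 oner_neq0.
have h02 := scales_volume_comp h01 (scales_volume_comp h12 h01).
wlog ij : i j / (i < j)%N.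
  move=> H; rewrite neq_ltn => /orP[] ij; first by apply: H => //; rewrite neq_ltn ij.
  by rewrite /tperm_mx tpermC; apply: H => //; rewrite neq_ltn ij.
move=> _.
have tE x : linear_map3 (tperm_mx i j) x = (vec3 x (tperm i j 0) 0, vec3 x (tperm i j 1) 0,
    vec3 x (tperm i j 2) 0).
  by rewrite /linear_map3 -row_permE !mxE.
move: i j ij tE; elim/ord3P; elim/ord3P => // _ tE.
- rewrite (_ : linear_map3 _ = fun x => (x.1.2, x.1.1, x.2))//.
  by apply/funext => x; rewrite tE tpermL tpermR tpermD// !mxE.
- rewrite (_ : linear_map3 _ = fun x => (x.2, x.1.2, x.1.1))//.
  by apply/funext => x; rewrite tE tpermL tpermR tpermD// !mxE.
- rewrite (_ : linear_map3 _ = fun x => (x.1.1, x.2, x.1.2))//.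
  by apply/funext => x; rewrite tE tpermL tpermR tpermD// !mxE.
Qed.

Lemma scales_volume_perm (s : 'S_3) : scales_volume (linear_map3 (perm_mx s)).
Proof.
have [ts -> tsP] := prod_tpermP s; elim: ts tsP => [|[i j] ts IH] /=.
  move=> _; rewrite big_nil perm_mx1.
  apply: scales_volume_lower => [i j ij|i]; rewrite mxE.
    by rewrite -val_eqE/= ltn_eqF.
  by rewrite eqxx oner_neq0.
move=> /andP[ij tsP]; rewrite big_cons perm_mxM linear_map3M.
by apply: scales_volume_comp; [exact: scales_volume_tperm|exact: IH].
Qed.

(** The LUP decomposition reduces [A] to a permutation and two triangular matrices. *)
Lemma scales_volume_unitmx A : A \in unitmx -> scales_volume (linear_map3 A).
Proof.
move=> uA.
have [P [L [U [/is_perm_mxP[s ->] Ll Uu eq_lu]]]] : exists P L U : 'M[R]_3,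
    [/\ is_perm_mx P, forall i j : 'I_3, (i <= j)%N -> L i j = (i == j)%:R,
       forall i j : 'I_3, (j < i)%N -> U i j = 0 & P *m A = L *m U].
  pose lup := cormen_lup A; exists lup.1.1, lup.1.2, lup.2; split.
  - exact: cormen_lup_perm.
  - exact: cormen_lup_lower.
  - exact: cormen_lup_upper.
  - move: (cormen_lup_correct A : let: (P, L, U) := lup in P * A = L * U).
    by case: lup => -[].
have detL : \det L = 1.
  rewrite det_trig; first by rewrite big1// => i _; rewrite Ll// eqxx.
  by apply/is_trig_mxP => i j ij; rewrite Ll ?(ltnW ij)// -val_eqE/= ltn_eqF.
(* [L] has determinant 1, and the permutation and [A] are invertible, so the product of the diagonal
   of [U] is nonzero. *)
have U0 i : U i i != 0.
  have : \det U != 0.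
    rewrite -[\det U]mul1r -detL -det_mulmx -eq_lu -unitfE.
    by rewrite -[_ \is a _]/(_ \in unitmx) unitmx_mul unitmx_perm.
  rewrite -det_tr det_trig; last first.
    by apply/is_trig_mxP => k j kj; rewrite mxE Uu.
  by move=> /prodf_neq0 /(_ i isT); rewrite mxE.
have -> : A = perm_mx s^-1 *m (L *m U).
  by rewrite -eq_lu mulmxA -perm_mxM mulVg perm_mx1 mul1mx.
rewrite !linear_map3M; apply: scales_volume_comp; first exact: scales_volume_perm.
apply: scales_volume_comp; last exact: scales_volume_upper.
apply: scales_volume_lower => [i j ij|i]; rewrite Ll ?(ltnW ij)//.
  by rewrite -val_eqE/= ltn_eqF.
by rewrite eqxx oner_neq0.
Qed.

End linear_map3.

(** * Geometry of the channel *)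

Section gram.
Context (R : realType).
Implicit Types a b y : 'cV[R]_3.

Definition dot3 a b : R := (a^T *m b) 0 0.

Lemma dot3E a b : dot3 a b = a 0 0 * b 0 0 + a 1 0 * b 1 0 + a 2 0 * b 2 0.
Proof.
rewrite /dot3 !mxE !big_ord_recl big_ord0 !mxE/= !addr0 addrA.
rewrite (_ : lift ord0 ord0 = 1); last exact/val_inj.
by rewrite (_ : lift ord0 (lift ord0 ord0) = 2); last exact/val_inj.
Qed.

Lemma enormE a : enorm a ^+ 2 = dot3 a a.
Proof.
rewrite /enorm sqr_sqrtr; first by rewrite /dot3 mxE; apply: eq_bigr => i _; rewrite mxE expr2.
by apply: sumr_ge0 => i _; exact: sqr_ge0.
Qed.

Lemma enorm_ge0 a : 0 <= enorm a. Proof. exact: sqrtr_ge0. Qed.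

Lemma dot3_eq0 a : dot3 a a = 0 -> a = 0.
Proof.
rewrite dot3E => a0; have [h0 h1 h2] : [/\ a 0 0 = 0, a 1 0 = 0 & a 2 0 = 0].
  by split; nra.
by apply/colP; elim/ord3P; rewrite ?h0 ?h1 ?h2 mxE.
Qed.

Lemma gram_gt0 a b : free [:: a; b] ->
  [/\ 0 < dot3 a a, 0 < dot3 b b & dot3 a b ^+ 2 < dot3 a a * dot3 b b].
Proof.
move=> ab.
have ge0 u : 0 <= dot3 u u by rewrite -enormE sqr_ge0.
have gt0 u : u != 0 -> 0 < dot3 u u.
  by move=> u0; rewrite lt_neqAle ge0 andbT eq_sym; apply: contra u0 => /eqP/dot3_eq0 ->.
have /and3P[] : [&& a \notin <[b]>%VS, b != 0 & true].
  by move: ab; rewrite free_cons span_seq1 seq1_free andbT.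
move=> aNb b0 _.
have a0 : a != 0 by apply: contraNneq aNb => ->; exact: mem0v.
split; [exact: gt0|exact: gt0|].
(* [w] is |b|^2 times the component of [a] orthogonal to [b]. Independence makes it nonzero, and its
   squared norm is |b|^2 times the gap in the Cauchy-Schwarz inequality. *)
pose w := dot3 b b *: a - dot3 a b *: b.
have wE : dot3 w w = dot3 b b * (dot3 a a * dot3 b b - dot3 a b ^+ 2).
  by rewrite /w !dot3E !mxE; ring.
have w0 : w != 0.
  apply: contra aNb; rewrite subr_eq0 => /eqP e; apply/vlineP.
  exists (dot3 a b / dot3 b b); rewrite mulrC -scalerA -e scalerA mulVf ?scale1r//.
  by rewrite gt_eqF// gt0.
by have := gt0 _ w0; rewrite wE pmulr_rgt0 ?gt0// subr_gt0.
Qed.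

End gram.

Section channel_geometry.
Context (R : realType) (v : 'cV[R[i]]_3).
Hypothesis v_free : free [:: vRe v; vIm v].

Lemma enorm_vRe_gt0 : 0 < enorm (vRe v).
Proof.
have [a0 _ _] := gram_gt0 v_free.
by rewrite lt_neqAle enorm_ge0 andbT eq_sym -sqrf_eq0 enormE gt_eqF.
Qed.

Lemma enorm_vIm_gt0 : 0 < enorm (vIm v).
Proof.
have [_ b0 _] := gram_gt0 v_free.
by rewrite lt_neqAle enorm_ge0 andbT eq_sym -sqrf_eq0 enormE gt_eqF.
Qed.

Lemma rho_sqr_lt1 : 0 < 1 - rho v ^+ 2.
Proof.
have [_ _ h] := gram_gt0 v_free; have := enorm_vRe_gt0; have := enorm_vIm_gt0.
move=> b0 a0; rewrite subr_gt0 /rho expr_div_n.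
rewrite ltr_pdivrMr ?mul1r ?exprn_gt0 ?mulr_gt0//.
by rewrite exprMn !enormE.
Qed.

Let a := vRe v.
Let b := vIm v.
Let s := Num.sqrt (1 - rho v ^+ 2).

Let a_gt0 : 0 < enorm a := enorm_vRe_gt0.
Let b_gt0 : 0 < enorm b := enorm_vIm_gt0.
Let rho_lt1 := rho_sqr_lt1.

Let rhoE : rho v * (enorm a * enorm b) = dot3 a b.
Proof. by rewrite /rho divfK// mulf_neq0// gt_eqF. Qed.

Let s_gt0 : 0 < s. Proof. by rewrite sqrtr_gt0. Qed.

Let s2 : s ^+ 2 = 1 - rho v ^+ 2. Proof. by rewrite sqr_sqrtr// ltW. Qed.

(** Forward substitution in the triangular system with matrix [chol v], followed by the squared
    norm. At (a.y, b.y) it is the squared length of the projection of y on the span of a and b. *)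
Definition channel_form (z : Rplane R) : R :=
  (z.1 / enorm a) ^+ 2 + ((z.2 / enorm b - rho v * (z.1 / enorm a)) / s) ^+ 2.

Lemma channel_form_ge0 z : 0 <= channel_form z.
Proof. by rewrite addr_ge0// sqr_ge0. Qed.

Lemma channel_formZ (N : R) z :
  channel_form (N * z.1, N * z.2) = N ^+ 2 * channel_form z.
Proof. by rewrite /channel_form/=; ring. Qed.

Lemma measurable_channel_form : measurable_fun setT channel_form.
Proof.
have m1 : measurable_fun setT (fun z : Rplane R => z.1 / enorm a).
  exact: measurable_realfun.measurable_funM.
apply: measurable_funD; first exact: measurable_funX.
apply: measurable_funX; apply: measurable_realfun.measurable_funM => //.
apply: measurable_funB; apply: measurable_realfun.measurable_funM => //.
Qed.

(** The case distinction in [psi] is absorbed by defaults: beyond 1 the root of a negative number is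
    0, and so is its inverse. *)
Lemma channel_pdfE (z : Rplane R) : channel_pdf v (z.1 +i* z.2)%C =
  (enorm a * enorm b * s * (2 * pi))^-1 * (Num.sqrt (1 - channel_form z))^-1.
Proof.
have chol_unit : chol v \in unitmx.
  rewrite unitmxE /chol (@det_lblock _ 1 1) det1 mul1r det_scalar1 unitfE.
  by rewrite gt_eqF.
rewrite /channel_pdf (_ : enorm _ ^+ 2 = channel_form z).
  rewrite /psi channel_form_ge0/= -/a -/b -/s.
  have [_|h] := leP (channel_form z) 1; first by rewrite !invfM !mulrA.
  by rewrite ler0_sqrtr ?subr_le0 ?ltW// invr0 !mulr0.
set x := (_ / _)%:M; set y := (_ / _)%:M.
pose y' : 'M[R]_1 := ((z.2 / enorm b - rho v * (z.1 / enorm a)) / s)%:M.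
(* The inverse of [chol v] is not expanded; instead, its value is exhibited as a vector that
   [chol v] sends to the given one. *)
have -> : col_mx x y = chol v *m col_mx x y'.
  rewrite /chol mul_block_col mul1mx mul0mx addr0 -!scalar_mxM -/s.
  congr (col_mx _ _); apply/matrixP => i j; rewrite !mxE !ord1 !mulr1n.
  by rewrite [s * _]mulrC divfK ?gt_eqF// addrC subrK.
rewrite mulKmx// /enorm sqr_sqrtr; last by apply: sumr_ge0 => i _; exact: sqr_ge0.
rewrite (@big_split_ord _ _ _ 1 1) !big_ord1 col_mxEu col_mxEd !mxE.
by rewrite !eqxx !mulr1n.
Qed.

(** The normalising factor is 1 / |a x b|, as |a x b| = |a| |b| sqrt (1 - rho^2). *)
Let n : 'cV[R]_3 := (enorm a * enorm b * s)^-1 *: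
  \col_i [:: a 1 0 * b 2 0 - a 2 0 * b 1 0; a 2 0 * b 0 0 - a 0 0 * b 2 0;
             a 0 0 * b 1 0 - a 1 0 * b 0 0]`_i.

Definition channel_frame : 'M[R]_3 := \matrix_(i, j) [:: a j 0; b j 0; n j 0]`_i.

Lemma linear_map3_frame x : linear_map3 channel_frame x =
  (dot3 a (vec3 x), dot3 b (vec3 x), dot3 n (vec3 x)).
Proof. by rewrite linear_map3E !dot3E !mxE. Qed.

(* Lagrange's identity |a|^2 |b|^2 - (a.b)^2 = |a x b|^2, completed by the
   expansion of y along a, b and a x b. *)
Lemma channel_form_dot y :
  channel_form (dot3 a y, dot3 b y) + dot3 n y ^+ 2 = dot3 y y.
Proof.
have h1 := enormE a; have h2 := enormE b.
have A0 : enorm a != 0 by rewrite gt_eqF.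
have B0 : enorm b != 0 by rewrite gt_eqF.
have S0 : s != 0 by rewrite gt_eqF.
(* [D] is |a x b|. Multiplying the identity by [D ^+ 2] clears all roots and denominators, leaving a
   polynomial identity in the coordinates of a, b and y. *)
pose D := enorm a * enorm b * s.
have D2 : D ^+ 2 = dot3 a a * dot3 b b - dot3 a b ^+ 2.
  by rewrite /D !exprMn s2 -rhoE -h1 -h2; ring.
have D0 : D ^+ 2 != 0 by rewrite expf_neq0// !mulf_neq0.
have QE : D ^+ 2 * channel_form (dot3 a y, dot3 b y) =
    dot3 b b * dot3 a y ^+ 2 - 2 * dot3 a b * dot3 a y * dot3 b y + dot3 a a * dot3 b y ^+ 2.
  rewrite -rhoE -h1 -h2 /channel_form /D /= !exprMn.
  transitivity (s ^+ 2 * enorm b ^+ 2 * dot3 a y ^+ 2 +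
     (enorm a * dot3 b y - rho v * enorm b * dot3 a y) ^+ 2).
    by field; rewrite A0 B0 S0.
  by rewrite s2; ring.
have nE : D ^+ 2 * dot3 n y ^+ 2 = (dot3 (D *: n) y) ^+ 2.
  by rewrite [dot3 (D *: n) y]dot3E dot3E !mxE; ring.
have Dn : D *: n = \col_i [:: a 1 0 * b 2 0 - a 2 0 * b 1 0; a 2 0 * b 0 0 - a 0 0 * b 2 0;
             a 0 0 * b 1 0 - a 1 0 * b 0 0]`_i.
  by rewrite /n scalerA mulfV ?scale1r// !mulf_neq0.
apply: (mulfI D0); rewrite mulrDr QE nE Dn D2 !dot3E !mxE/=; ring.
Qed.

(** A vector killed by the frame is orthogonal to a, b and n, so [channel_form_dot] gives it norm
    0. *)
Lemma channel_frame_unit : channel_frame \in unitmx.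
Proof.
rewrite -unitmx_tr -row_free_unit -kermx_eq0; apply/rowV0P => u /sub_kermxP uG.
have Gu : channel_frame *m u^T = 0 by rewrite -[LHS]trmxK trmx_mul trmxK uG trmx0.
have dotu (i : 'I_3) (c : 'cV[R]_3) : (forall j, channel_frame i j = c j 0) -> dot3 c u^T = 0.
  move=> ic; have := congr1 (fun M : 'cV[R]_3 => M i 0) Gu; rewrite !mxE => <-.
  by rewrite /dot3 mxE; apply: eq_bigr => j _; rewrite !mxE -ic !mxE.
have := channel_form_dot u^T.
rewrite (dotu 0 a) ?(dotu 1 b) ?(dotu 2 n); try by move=> j; rewrite mxE.
rewrite expr0n addr0 /channel_form/= !mul0r mulr0 subr0 mul0r expr0n addr0.
by move/esym/dot3_eq0 => u0; rewrite -[u]trmxK u0 trmx0.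
Qed.

Lemma ReIm_channel o : (complex.Re (channel o v), complex.Im (channel o v)) =
  (dot3 a (vec3 o), dot3 b (vec3 o)).
Proof.
rewrite !dot3E /channel !mxE !big_ord_recl big_ord0 !mxE/=.
rewrite (_ : lift ord0 ord0 = 1); last exact/val_inj.
rewrite (_ : lift ord0 (lift ord0 ord0) = 2); last exact/val_inj.
by case: (v 0 0) => ? ?; case: (v 1 0) => ? ?; case: (v 2 0) => ? ?;
  congr (_, _) => /=; ring.
Qed.

(** By [channel_form_dot] the radius used in [solid_cone], taken at the frame image of y, is |y|;
    dividing y by it lands on the sphere. *)
Lemma cone_channel (B : set (Rplane R)) :
  [set y | exists (r : R) (x : Rspace R),
     [/\ 0 < r <= 1, B (complex.Re (channel x v), complex.Im (channel x v)),
         unit_sphere x & y = scale3 r x]] =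
  linear_map3 channel_frame @^-1` solid_cone channel_form B.
Proof.
have dotZ c r x : dot3 c (vec3 (scale3 r x)) = r * dot3 c (vec3 x).
  by rewrite !dot3E !mxE/=; ring.
have normE y : Num.sqrt (channel_form (linear_map3 channel_frame y).1 +
    (linear_map3 channel_frame y).2 ^+ 2) = enorm (vec3 y).
  by rewrite linear_map3_frame channel_form_dot -enormE sqrtr_sqr ger0_norm ?enorm_ge0.
have normZ r x : 0 <= r -> enorm (vec3 (scale3 r x)) = r * enorm (vec3 x).
  move=> r0; apply/(@pexpIrn _ 2); rewrite ?nnegrE ?mulr_ge0 ?enorm_ge0//.
  by rewrite exprMn !enormE dotZ !dot3E !mxE/=; ring.
have coneE y : (linear_map3 channel_frame @^-1` solid_cone channel_form B) y =
    ((0 < enorm (vec3 y) <= 1) /\ B ((enorm (vec3 y))^-1 * dot3 a (vec3 y),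
                                     (enorm (vec3 y))^-1 * dot3 b (vec3 y))).
  by rewrite /preimage /solid_cone /mkset normE linear_map3_frame.
apply/seteqP; split => y; rewrite coneE.
  move=> [r [x [/andP[r0 r1] Bx x1 ->]]]; rewrite normZ ?(ltW r0)// x1 mulr1.
  split; first exact/andP.
  by rewrite !dotZ !mulKf ?gt_eqF// -ReIm_channel.
move=> [/andP[r0 r1] By]; set r := enorm _ in r0 r1 By.
exists r, (scale3 r^-1 y); rewrite ReIm_channel !dotZ; split => //; first exact/andP.
  by rewrite /unit_sphere/= normZ ?invr_ge0 ?(ltW r0)// mulVf ?gt_eqF.
by rewrite /scale3/= !mulVKf ?gt_eqF//; case: (y) => -[].
Qed.

End channel_geometry.

(** * Marginals and law of the channel *)

Section marginal.
Context (R : realType).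
Local Notation mu := (@lebesgue_measure R).
Local Open Scope ereal_scope.

(** For |x0| < 1, scaling t by C = sqrt (1 - x0^2) reduces to the arcsine integral, and C cancels.
    Otherwise the radicand is never positive and the integrand is 0 by default. *)
Lemma integral_inv_sqrt_sub_sqr (x0 : R) :
  \int[mu]_t (Num.sqrt (1 - x0 ^+ 2 - t ^+ 2))^-1%:E =
  (pi * \1_(`](-1)%R, 1%R[%classic) x0)%:E.
Proof.
have x1E : (x0 \in `](-1)%R, 1%R[%classic) = (0 < 1 - x0 ^+ 2)%R.
  rewrite mem_setE in_itv/=; apply/idP/idP => [/andP[? ?]|?]; first by nra.
  by apply/andP; split; nra.
rewrite indicE x1E; case: ltP => [C0|C0]; last first.
  rewrite mulr0 integral0_eq// => t _.
  by rewrite ler0_sqrtr ?invr0// (le_trans _ C0)// gerBl sqr_ge0.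
rewrite mulr1 -integral_arcsine.
pose C := Num.sqrt (1 - x0 ^+ 2).
have C2 : (C ^+ 2 = 1 - x0 ^+ 2)%R by rewrite sqr_sqrtr// ltW.
have C_gt0 : (0 < C)%R by rewrite sqrtr_gt0.
pose g (t : R) := (Num.sqrt (1 - x0 ^+ 2 - t ^+ 2))^-1%:E.
have mg : measurable_fun setT g.
  by apply/measurable_EFinP/measurable_funV/measurable_sqrt/measurable_funB.
have g0 t : 0 <= g t by rewrite lee_fin invr_ge0.
rewrite -(ge0_integral_affine 0 (lt0r_neq0 C_gt0) mg g0).
rewrite -ge0_integralZl//; last first.
  apply: (measurableT_comp mg); exact: measurable_funD.
rewrite [RHS]integral_mkcond; apply: eq_integral => u _.
rewrite patchE mem_setE in_itv/= /g addr0 -C2 exprMn.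
rewrite -[X in (X - _)%R]mulr1 -mulrBr sqrtrM ?sqr_ge0// sqrtr_sqr gtr0_norm//.
rewrite -EFinM invfM mulVKf ?gt_eqF//.
rewrite -ltr_norml; case: ltP => // u1.
rewrite ler0_sqrtr ?invr0// subr_le0 -[leRHS]real_normK ?num_real//.
by rewrite exprn_ege1.
Qed.

(** [uniform_pdf] lives on the closed interval, the indicator on the open one; removing the two
    endpoints, a null set, makes them agree. *)
Lemma uniform_probE (A : R) (A0 : (- A < A)%R) (B : set R) : measurable B ->
  \int[mu]_(x in B) ((2 * A)^-1 * \1_(`](-A)%R, A[%classic) x)%:E = uniform_prob A0 B.
Proof.
move=> mB; rewrite /uniform_prob.
have mf D : measurable_fun D (fun x : R => ((2 * A)^-1 * \1_(`](-A)%R, A[%classic) x)%:E).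
  apply/measurable_EFinP/measurable_funTS/measurable_realfun.measurable_funM => //.
have mu' D : measurable_fun D (fun x : R => (uniform_pdf (- A) A x)%:E).
  by apply/measurable_EFinP/measurable_funTS; exact: measurable_uniform_pdf.
have mB1 : measurable (B `\ (- A)%R) by exact: measurableD.
have mB2 : measurable (B `\ (- A)%R `\ A) by exact: measurableD.
rewrite -(integral_setD1 mB1 (mf _)) -(integral_setD1 mB2 (mf _)).
rewrite -[RHS](integral_setD1 mB1 (mu' _)) -[RHS](integral_setD1 mB2 (mu' _)).
apply: eq_integral => x; rewrite inE/= => -[[_ xNA] xA]; congr EFin.
rewrite indicE mem_setE in_itv/= /uniform_pdf opprK.
rewrite !lt_neqAle [(- A == x)%R]eq_sym; move/eqP/negbTE: xNA => ->; move/eqP/negbTE: xA => ->.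
by case: ifP; rewrite ?mulr1 ?mulr0// mulr2n mulrDl mul1r.
Qed.

End marginal.

Section channel_marginal.
Context (R : realType) (v : 'cV[R[i]]_3).
Hypothesis v_free : free [:: vRe v; vIm v].
Local Notation mu := (@lebesgue_measure R).
Local Open Scope ereal_scope.

Let f (z : Rplane R) : R := channel_pdf v (z.1 +i* z.2)%C.

Lemma channel_pdf_ge0 z : (0 <= f z)%R.
Proof.
rewrite /f channel_pdfE// mulr_ge0 ?invr_ge0//.
by rewrite !mulr_ge0 ?enorm_ge0 ?pi_ge0.
Qed.

Lemma measurable_channel_pdf : measurable_fun setT f.
Proof.
have -> : f = fun z => ((enorm (vRe v) * enorm (vIm v) *
    Num.sqrt (1 - rho v ^+ 2) * (2 * pi))^-1 *
    (Num.sqrt (1 - channel_form v z))^-1)%R.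
  by apply/funext => z; exact: channel_pdfE.
apply: measurable_realfun.measurable_funM => //.
apply/measurable_funV/measurable_sqrt/measurable_funB => //.
exact: measurable_channel_form.
Qed.

(** At fixed p the inner integral is affine in q up to [integral_inv_sqrt_sub_sqr], which yields pi
    for |p| < |a|; this pi cancels the one in [psi] and leaves 1 / (2 |a|). *)
Lemma integral_channel_pdf (B : set R) (A0 : (- enorm (vRe v) < enorm (vRe v))%R) :
  measurable B ->
  \int[lebesgue2 R]_(z in B `*` setT) (f z)%:E = uniform_prob A0 B.
Proof.
move=> mB; rewrite -uniform_probE//.
have mBT : measurable (B `*` setT : set (Rplane R)) by exact: measurableX.
have mf : measurable_fun setT (fun z => (f z)%:E) by apply/measurable_EFinP; exact: measurable_channel_pdf.
rewrite integral_mkcond fubini_tonelli1; last 2 first.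
- by apply/(measurable_restrictT _ mBT)/measurable_funTS.
- by move=> z; rewrite patchE; case: ifP => // _; rewrite lee_fin channel_pdf_ge0.
rewrite [RHS]integral_mkcond; apply: eq_integral => p _.
rewrite /fubini_F patchE; case: ifPn => pB; last first.
  apply: integral0_eq => q _; rewrite patchE; case: ifPn => //.
  by rewrite inE/= => -[]; rewrite notin_setE in pB.
set a := enorm (vRe v); set b := enorm (vIm v); set r := rho v.
set s := Num.sqrt (1 - r ^+ 2).
have a_gt0 : (0 < a)%R by exact: enorm_vRe_gt0.
have b_gt0 : (0 < b)%R by exact: enorm_vIm_gt0.
have s_gt0 : (0 < s)%R by rewrite sqrtr_gt0 rho_sqr_lt1.
pose g (t : R) := (Num.sqrt (1 - (p / a) ^+ 2 - t ^+ 2))^-1%:E.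
have mg : measurable_fun setT g.
  by apply/measurable_EFinP/measurable_funV/measurable_sqrt/measurable_funB.
have g0 t : 0 <= g t by rewrite lee_fin invr_ge0.
(* The substitution is t = (q / b - rho p / a) / s, with slope 1 / (b s). *)
have c0 : ((b * s)^-1 != 0)%R by rewrite invr_eq0 mulf_neq0// gt_eqF.
have := ge0_integral_affine (- (r * (p / a)) / s)%R c0 mg g0.
rewrite integral_inv_sqrt_sub_sqr => gE.
have k0 : (0 <= (a * (2 * pi))^-1 :> R)%R.
  by rewrite invr_ge0 !mulr_ge0 ?pi_ge0// ltW.
transitivity ((a * (2 * pi))^-1%:E * (`|(b * s)^-1|%:E *
    \int[mu]_x g ((b * s)^-1 * x + - (r * (p / a)) / s)%R)).
  rewrite muleA -EFinM -ge0_integralZl//; last 2 first.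
  - apply: (measurableT_comp mg); exact: measurable_funD.
  - by rewrite lee_fin mulr_ge0.
  apply: eq_integral => q _; rewrite patchE.
  rewrite (_ : _ \in _ = true); last by apply: mem_set; split => //=; exact: set_mem pB.
  rewrite /f channel_pdfE// /g -EFinM /channel_form/= -/a -/b -/r -/s; congr EFin.
  rewrite gtr0_norm ?invr_gt0 ?mulr_gt0//; congr (_ * _)%R.
    by rewrite -invfM; congr (_^-1)%R; ring.
  rewrite opprD addrA; congr (Num.sqrt (_ - _ ^+ 2))^-1%R.
  by field; rewrite !gt_eqF.
rewrite gE -EFinM; congr EFin; rewrite !indicE !mem_setE !in_itv/=.
rewrite ltr_pdivlMr// ltr_pdivrMr// mul1r mulN1r.
case: (_ && _); rewrite ?mulr0// !mulr1.
by move: (pi) (pi_gt0 R) => c c_gt0; field; rewrite !gt_eqF.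
Qed.

Lemma integral_channel_pdfT : \int[lebesgue2 R]_z (f z)%:E = 1.
Proof.
have A0 : (- enorm (vRe v) < enorm (vRe v))%R by rewrite -subr_gt0 opprK addr_gt0 ?enorm_vRe_gt0.
have := integral_channel_pdf A0 measurableT; rewrite setXTT => ->.
exact: probability_setT (uniform_prob A0).
Qed.

End channel_marginal.

(** * From the uniform law on the sphere to the law of the channel *)

Section channel_law.
Context (R : realType) (d : measure_display) (T : measurableType d).
Context (P : probability T R) (oR : {RV P >-> Rspace R}).
Hypothesis oR_unif : uniform_on_sphere oR.
Local Open Scope ereal_scope.

Definition channel_plane (v : 'cV[R[i]]_3) (o : Rspace R) : Rplane R :=
  (complex.Re (channel o v), complex.Im (channel o v)).

Lemma measurable_channel_plane v : measurable_fun setT (channel_plane v).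
Proof.
have md (c : 'cV[R]_3) : measurable_fun setT (fun o : Rspace R => dot3 c (vec3 o)).
  rewrite (_ : (fun _ => _) = (fun o : Rspace R =>
      c 0 0 * o.1.1 + c 1 0 * o.1.2 + c 2 0 * o.2)%R); last first.
    by apply/funext => o; rewrite dot3E !mxE.
  apply: measurable_funD; last exact: measurableT_comp.
  apply: measurable_funD; apply: measurableT_comp => //; exact: measurableT_comp.
rewrite (_ : channel_plane v = fun o => (dot3 (vRe v) (vec3 o), dot3 (vIm v) (vec3 o))).
  by apply: measurable_fun_pair; exact: md.
by apply/funext => o; exact: ReIm_channel.
Qed.

Lemma channel_law v (B : set (Rplane R)) : free [:: vRe v; vIm v] -> measurable B ->
  P ((channel_plane v \o oR) @^-1` B) =
  \int[lebesgue2 R]_(z in B) (channel_pdf v (z.1 +i* z.2)%C)%:E.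
Proof.
move=> vf mB.
have mL := measurable_channel_plane v.
have [_ [c cE]] := scales_volume_unitmx (channel_frame_unit vf).
have [k kE] := lebesgue3_solid_cone (measurable_channel_form v) (channel_form_ge0 v)
  (channel_formZ v).
pose I (A : set (Rplane R)) :=
  \int[lebesgue2 R]_(z in A) (Num.sqrt (1 - channel_form v z))^-1%:E.
pose q : R := (enorm (vRe v) * enorm (vIm v) * Num.sqrt (1 - rho v ^+ 2) * (2 * pi))^-1%R.
have q_gt0 : (0 < q)%R.
  rewrite invr_gt0 !mulr_gt0 ?pi_gt0 ?enorm_vRe_gt0 ?enorm_vIm_gt0//.
  by rewrite sqrtr_gt0 rho_sqr_lt1.
have fE A : measurable A ->
    \int[lebesgue2 R]_(z in A) (channel_pdf v (z.1 +i* z.2)%C)%:E = q%:E * I A.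
  move=> mA; rewrite -ge0_integralZl//; last 2 first.
  - apply/measurable_EFinP/measurable_funTS/measurable_funV/measurable_sqrt.
    by apply: measurable_funB => //; exact: measurable_channel_form.
  - by rewrite lee_fin ltW.
  by apply: eq_integral => z _; rewrite channel_pdfE.
(* [K] gathers the normalisation of the surface measure, the 3 of its definition, the volume factor
   of the frame and the constant of the solid cone. *)
have [K KE] : exists K : \bar R, forall A, measurable A ->
    P ((channel_plane v \o oR) @^-1` A) = K * I A.
  exists ((fine (surface_measure (@unit_sphere R)))^-1%:E * (3%:E * (c%:E * k))).
  move=> A mA.
  have mLA : measurable (channel_plane v @^-1` A).
    by rewrite -[X in measurable X]setTI; exact: mL.
  have mS : measurable (solid_cone (channel_form v) A).
    by apply: measurable_solid_cone => //; exact: measurable_channel_form.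
  rewrite comp_preimage.
  rewrite -[LHS]/(distribution P oR (channel_plane v @^-1` A)) (oR_unif mLA).
  rewrite /surface_measure -!muleA; congr (_ * (_ * _)).
  by rewrite (cone_channel vf) cE// kE.
rewrite fE// KE//.
have := KE _ measurableT; rewrite preimage_setT probability_setT.
have := fE _ measurableT; rewrite integral_channel_pdfT// => I1 K1.
suff -> : K = q%:E by [].
(* On the whole plane [q * I = 1] and [K * I = 1], so K = K * (q * I) = q * (K * I) = q. This takes
   no division, although [K] and [I] are extended reals. *)
rewrite -[LHS]mule1 I1 muleA -muleA.
by rewrite muleCA -K1 mule1.
Qed.

Lemma channel_Re_law v : free [:: vRe v; vIm v] ->
  has_uniform_law P (fun w => complex.Re (channel (oR w) v))
    (- enorm (vRe v)) (enorm (vRe v)).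
Proof.
move=> vf; split.
  exact: (measurableT_comp measurable_fst
    (measurableT_comp (measurable_channel_plane v) (measurable_funP oR))).
have A0 : (- enorm (vRe v) < enorm (vRe v))%R by rewrite -subr_gt0 opprK addr_gt0 ?enorm_vRe_gt0.
exists A0 => B mB; rewrite -(integral_channel_pdf vf A0 mB).
rewrite -channel_law//; last exact: measurableX.
by congr (P _); apply/seteqP; split => w //= [].
Qed.

End channel_law.

(** The swapped vector is j times the conjugate of [v]. As [o] is real, the channel undergoes the
    same swap. *)
Lemma channel_swap (R : realType) (v : 'cV[R[i]]_3) (o : Rspace R) :
  complex.Re (channel o (map_mx (fun z : R[i] => (complex.Im z +i* complex.Re z)%C) v)) =
  complex.Im (channel o v).
Proof.
have /(congr1 fst)/= -> := ReIm_channel (map_mx (fun z : R[i] => (complex.Im z +i* complex.Re z)%C) v) o.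
have /(congr1 snd)/= -> := ReIm_channel v o.
by rewrite !dot3E !mxE.
Qed.

Theorem proposition3 (R : realType) (d : measure_display)
    (T : measurableType d) (P : probability T R)
    (oR : {RV P >-> Rspace R}) (v : 'cV[R[i]]_3)
    (oR_unif : uniform_on_sphere oR)
    (v_free : free [:: vRe v; vIm v]) :
  let h := fun w : T => channel (oR w) v in
  [/\ has_density P (fun w => (complex.Re (h w), complex.Im (h w)) : Rplane R)
        (lebesgue2 R) (fun z : Rplane R => channel_pdf v (z.1 +i* z.2)%C),
      has_uniform_law P (fun w => complex.Re (h w))
        (- enorm (vRe v)) (enorm (vRe v)) &
      has_uniform_law P (fun w => complex.Im (h w))
        (- enorm (vIm v)) (enorm (vIm v))].
Proof.
move=> h; split.
- split.
  + exact: (measurableT_comp (measurable_channel_plane v) (measurable_funP oR)).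
  + exact: measurable_channel_pdf.
  + by move=> z; exact: channel_pdf_ge0.
  + by move=> B mB; exact: channel_law.
- exact: channel_Re_law.
- pose v' := map_mx (fun z : R[i] => (complex.Im z +i* complex.Re z)%C) v.
  have reE : vRe v' = vIm v by apply/colP => i; rewrite !mxE.
  have imE : vIm v' = vRe v by apply/colP => i; rewrite !mxE.
  have vf : free [:: vRe v'; vIm v'].
    by rewrite reE imE; rewrite (@perm_free _ _ _ [:: vRe v; vIm v])// (perm_catC [:: _] [:: _]).
  have := channel_Re_law oR_unif vf; rewrite reE.
  by rewrite (_ : (fun w => _) = fun w => complex.Im (h w))//; apply/funext => w; exact: channel_swap.
Qed.
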